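(* For every integer $n\ge 0$, $$C_{n+1}C_{n+2}=\sum_{k=0}^{n}\frac{(2k+2)(2k+4)(8nk+6n+14k+12)}{(2n+2)(2n+3)(2n+4)(2n+5)(2n+6)}\binom{2n+3}{n-k}\binom{2n+6}{n-k+2},$$ $$C_{n+1}^2=\sum_{k=0}^{n}\frac{(2k+2)(2k+3)(2k+4)}{(2n+2)(2n+3)(2n+4)^2}\binom{2n+4}{n-k}\binom{2n+4}{n-k+1},$$ $$C_{n+1}C_{n+2}=\sum_{k=0}^{n}\frac{(2k+2)(2k+4)(8nk+18n+14k+30)}{(2n+2)(2n+3)(2n+4)(2n+5)(2n+6)}\binom{2n+3}{n-k}\binom{2n+6}{n-k+1}.$$
   Context: $C_n=\frac{1}{n+1}\binom{2n}{n}$ is the $n$-th Catalan number. *)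

(* Defs.v *)
From mathcomp Require Import all_boot all_order all_algebra.

Set Implicit Arguments.
Unset Strict Implicit.
Unset Printing Implicit Defensive.

Import GRing.Theory.
Local Open Scope ring_scope.

Definition catalan (n : nat) : rat := (n.+1)%:R^-1 * 'C(2 * n, n)%:R.

(* Main.v *)
(* Each sum telescopes in k. In the first and third, write N = 2n+3, M = 2n+6
   and a = 2, resp. a = 1; in the second, N = M = 2n+4 and a = 1. With j = n - k, the
   summand is a constant times G k - G k.+1, where
     G k = (j+1) (j+1+a) C(N, j+1) C(M, j+1+a) q k
   for a polynomial q of degree 2 in k: by
     (j+1) C(N, j+1) = (N-j) C(N, j),
   dividing by C(N, j) C(M, j+a) leaves a polynomial identity. As G vanishes at
   k = n+1, the sum is a multiple of G 0, which is a product of near-central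
   binomials. *)
Require Import Defs.
From mathcomp Require Import all_boot all_order all_algebra.
From mathcomp Require Import ring.

Set Implicit Arguments.
Unset Strict Implicit.
Unset Printing Implicit Defensive.

Import GRing.Theory Num.Theory.
Local Open Scope ring_scope.

(** Subtracting in the ring rather than in [nat] lets this hold for all [j]: once [j] exceeds [N],
    both binomials vanish. *)
Lemma natr_mul_bin_left (R : pzRingType) (N j : nat) :
  j.+1%:R * 'C(N, j.+1)%:R = (N%:R - j%:R) * 'C(N, j)%:R :> R.
Proof.
have [le_jN | lt_Nj] := leqP j N.
  by rewrite -natrB // -!natrM mul_bin_left.
by rewrite !bin_small ?mulr0 // ltnS ltnW.
Qed.

Lemma sum_bin_bin_telescope (R : comPzRingType) (n N M a : nat) (p q : nat -> R) :
  (forall k, (k <= n)%N ->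
     p k = (N%:R - (n - k)%:R) * (M%:R - (n - k + a)%:R) * q k
           - (n - k)%:R * (n - k + a)%:R * q k.+1) ->
  \sum_(0 <= k < n.+1) p k * 'C(N, n - k)%:R * 'C(M, n - k + a)%:R
  = n.+1%:R * (n.+1 + a)%:R * 'C(N, n.+1)%:R * 'C(M, n.+1 + a)%:R * q 0%N.
Proof.
move=> pE.
pose G k := (n.+1 - k)%:R * (n.+1 - k + a)%:R * 'C(N, n.+1 - k)%:R
            * 'C(M, n.+1 - k + a)%:R * q k.
(* The sign turns [G k - G k.+1] into a forward difference; the boundary term at [k = n.+1] dies
   through the factor [(n.+1 - k)%:R]. *)
rewrite (telescope_sumr_eq (fun k => - G k)) //.
  by rewrite /G subnn subn0; ring.
move=> k /andP[_ lt_kn]; rewrite pE // /G subSS (@subSn k n lt_kn) addSn.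
have eN := natr_mul_bin_left R N (n - k).
have eM := natr_mul_bin_left R M (n - k + a).
set j := (n - k)%N in eN eM *.
have -> : j.+1%:R * (j + a).+1%:R * 'C(N, j.+1)%:R * 'C(M, (j + a).+1)%:R * q k
  = (j.+1%:R * 'C(N, j.+1)%:R) * ((j + a).+1%:R * 'C(M, (j + a).+1)%:R) * q k by ring.
by rewrite eN eM; ring.
Qed.

(** This lemma and the next two turn unit moves in Pascal's triangle into rational factors that
    [field] can simplify. *)
Lemma natr_bin_left (N j : nat) :
  'C(N, j.+1)%:R = (N%:R - j%:R) / (j%:R + 1) * 'C(N, j)%:R :> rat.
Proof.
have j1 : j%:R + 1 != 0 :> rat by rewrite natr1 pnatr_eq0.
by apply: (mulfI j1); rewrite natr1 natr_mul_bin_left -natr1; field.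
Qed.

Lemma natr_bin_diag (N j : nat) :
  'C(N.+1, j.+1)%:R = (N%:R + 1) / (j%:R + 1) * 'C(N, j)%:R :> rat.
Proof.
have j1 : j%:R + 1 != 0 :> rat by rewrite natr1 pnatr_eq0.
by apply: (mulfI j1); rewrite natr1 -natrM -mul_bin_diag natrM -!natr1; field.
Qed.

Lemma natr_bin_down (N j : nat) : (j <= N)%N ->
  'C(N.+1, j)%:R = (N%:R + 1) / (N%:R + 1 - j%:R) * 'C(N, j)%:R :> rat.
Proof.
move=> le_jN; have leS := leqW le_jN.
have nz : N%:R + 1 - j%:R != 0 :> rat.
  by rewrite natr1 -natrB // subSn // pnatr_eq0.
apply: (mulfI nz); rewrite {1}natr1 -natrB // -natrM -mul_bin_down natrM -natr1.
by field.
Qed.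

Lemma natrDS_neq0 (R : numDomainType) (a b : nat) : a%:R + b.+1%:R != 0 :> R.
Proof. by rewrite -natrD pnatr_eq0 addnS. Qed.

(** These are the binomials left in [G 0] and in [catalan (n + 2)]. Expressing all of them through
    the central binomial [B] of [catalan (n + 1)] reduces each final evaluation to an identity of
    rational functions in [n]. *)
Lemma near_central_bins (n : nat) (x := n%:R : rat)
    (B := 'C(2 * (n + 1), n + 1)%:R : rat) :
  [/\ 'C(2 * (n + 2), n + 2)%:R = 2 * (2 * x + 3) / (x + 2) * B,
      'C(2 * n + 3, n + 1)%:R = (2 * x + 3) / (x + 2) * B,
      'C(2 * n + 4, n + 1)%:R = 2 * (2 * x + 3) / (x + 3) * B,
      'C(2 * n + 6, n + 3)%:R
        = 4 * (2 * x + 3) * (2 * x + 5) / ((x + 2) * (x + 3)) * B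
    & 'C(2 * n + 6, n + 2)%:R
        = 4 * (2 * x + 3) * (2 * x + 5) / ((x + 2) * (x + 4)) * B].
Proof.
have x2 : x + 2 != 0 := natrDS_neq0 _ n 1.
have x3 : x + 3 != 0 := natrDS_neq0 _ n 2.
have x4 : x + 4 != 0 := natrDS_neq0 _ n 3.
have natrS k : (n + k)%:R = x + k%:R by rewrite natrD.
have natr2S k : (2 * n + k)%:R = 2 * x + k%:R by rewrite natrD natrM.
have le_n2 i j : (i <= j)%N -> (n + i <= 2 * n + j)%N.
  by move=> le_ij; rewrite leq_add // leq_pmull.
(* The path in Pascal's triangle goes down twice in column [n + 1], then twice along the diagonal;
   the two remaining values are one move away from [b5] and [b4]. *)
have b3 : 'C(2 * n + 3, n + 1)%:R = (2 * x + 3) / (x + 2) * B.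
  by rewrite addnS natr_bin_down ?le_n2 // natrS natr2S /B mulnDr; field;
    rewrite ?x2 ?x3 ?x4.
have b4 : 'C(2 * n + 4, n + 1)%:R = 2 * (2 * x + 3) / (x + 3) * B.
  by rewrite addnS natr_bin_down ?le_n2 // natrS natr2S b3; field;
    rewrite ?x2 ?x3 ?x4.
have b5 : 'C(2 * n + 5, n + 2)%:R
          = 2 * (2 * x + 3) * (2 * x + 5) / ((x + 2) * (x + 3)) * B.
  by rewrite !addnS natr_bin_diag -!addnS natrS natr2S b4; field;
    rewrite ?x2 ?x3 ?x4.
have b6 : 'C(2 * n + 6, n + 3)%:R
          = 4 * (2 * x + 3) * (2 * x + 5) / ((x + 2) * (x + 3)) * B.
  by rewrite !addnS natr_bin_diag -!addnS natrS natr2S b5; field;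
    rewrite ?x2 ?x3 ?x4.
split=> //; last first.
  by rewrite (addnS _ 5) natr_bin_down ?le_n2 // natrS natr2S b5; field;
    rewrite ?x2 ?x3 ?x4.
by rewrite mulnDr (addnS n 1) natr_bin_left natrS natr2S b4; field;
    rewrite ?x2 ?x3 ?x4.
Qed.

Theorem corollary3p5 (n : nat) :
  [/\ catalan (n + 1) * catalan (n + 2) =
        \sum_(0 <= k < n.+1)
          ((2 * k + 2) * (2 * k + 4) * (8 * n * k + 6 * n + 14 * k + 12))%N%:R
          / ((2 * n + 2) * (2 * n + 3) * (2 * n + 4) * (2 * n + 5)
             * (2 * n + 6))%N%:R
          * 'C(2 * n + 3, n - k)%:R * 'C(2 * n + 6, n - k + 2)%:R,
      catalan (n + 1) ^+ 2 =
        \sum_(0 <= k < n.+1)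
          ((2 * k + 2) * (2 * k + 3) * (2 * k + 4))%N%:R
          / ((2 * n + 2) * (2 * n + 3) * (2 * n + 4) ^ 2)%N%:R
          * 'C(2 * n + 4, n - k)%:R * 'C(2 * n + 4, n - k + 1)%:R
    & catalan (n + 1) * catalan (n + 2) =
        \sum_(0 <= k < n.+1)
          ((2 * k + 2) * (2 * k + 4) * (8 * n * k + 18 * n + 14 * k + 30))%N%:R
          / ((2 * n + 2) * (2 * n + 3) * (2 * n + 4) * (2 * n + 5)
             * (2 * n + 6))%N%:R
          * 'C(2 * n + 3, n - k)%:R * 'C(2 * n + 6, n - k + 1)%:R].
Proof.
have [c2 b3 b4 b63 b62] := near_central_bins n.
have nz (m : nat) : n%:R + m.+1%:R != 0 :> rat := natrDS_neq0 _ n m.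
have nz2 (m : nat) : 2 * n%:R + m.+1%:R != 0 :> rat.
  by rewrite -natrM; apply: natrDS_neq0.
have nzE := (nz 0, nz 1, nz 2, nz 3, nz2 1, nz2 2, nz2 3, nz2 4, nz2 5).
rewrite /catalan c2 -(addnS n 2).
set B := 'C(2 * (n + 1), n + 1)%:R in c2 b3 b4 b63 b62 *.
split.
(* The hypothesis of the telescoping lemma forces [q]: at [k = n] the term in [q k.+1] is zero,
   which gives [q n], and descending in [k] gives the rest. The constant denominator of the summand
   is absorbed into [q]. *)
- rewrite (sum_bin_bin_telescope (q := fun k : nat =>
    (8 * k%:R ^+ 2 + 12 * k%:R + 4 * n%:R + 8)
    / ((2 * n + 2) * (2 * n + 3) * (2 * n + 4) * (2 * n + 5) * (2 * n + 6))%N%:R)).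
    by rewrite -(addn1 n) -addnA b3 b63; field; rewrite ?nzE.
  by move=> k le_kn; rewrite (natrD _ (n - k)) natrB //; field; rewrite ?nzE.
(* Solving for [q] here produces a further denominator [2 * n + 3]. *)
- rewrite (sum_bin_bin_telescope (q := fun k : nat =>
    (4 * k%:R ^+ 2 + 8 * k%:R + 2 * n%:R + 6)
    / ((2 * n + 3) * ((2 * n + 2) * (2 * n + 3) * (2 * n + 4) ^ 2))%N%:R)).
    (* The second binomial of [G 0] is now the central one, ['C(2 * n + 4, n + 2)], so [c2]
       evaluates it. *)
    rewrite -(addn1 n) -addnA b4 (mulnDr 2 n 2) in c2 *.
    by rewrite c2; field; rewrite ?nzE.
  by move=> k le_kn; rewrite (natrD _ (n - k)) natrB //; field; rewrite ?nzE.
- rewrite (sum_bin_bin_telescope (q := fun k : nat =>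
    (8 * k%:R ^+ 2 + 20 * k%:R + 4 * n%:R + 16)
    / ((2 * n + 2) * (2 * n + 3) * (2 * n + 4) * (2 * n + 5) * (2 * n + 6))%N%:R)).
    by rewrite -(addn1 n) -addnA b3 b62; field; rewrite ?nzE.
  by move=> k le_kn; rewrite (natrD _ (n - k)) natrB //; field; rewrite ?nzE.
Qed.
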